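(* Let $m=m_n\ge 1$ and $d=d_n$ be integers with $2\le d\le n$ and $m \ll \binom{n}{d}^{1/2}$. Let $H_{nmd}$ be a hypergraph sampled uniformly at random from the set of hypergraphs on node set $\{1,\dots,n\}$ having exactly $m$ distinct hyperedges, each of size $d$. Then, as $n\to\infty$, \[ \mathbb{P}(H_{nmd} \text{ is connected}) \to \begin{cases} 0 & \text{if } \log n + m\log(1-d/n) \to +\infty,\\ 1 & \text{if } \log n + m\log(1-d/n) \to -\infty.\end{cases} \]
   Context: A hypergraph on node set $V$ is a collection of nonempty subsets (hyperedges) of $V$; it is connected if for every partition of $V$ into nonempty sets $V_1,V_2$ some hyperedge meets both $V_1$ and $V_2$. $a_n\ll b_n$ means $a_n/|b_n|\to0$. The convention $\log 0 = -\infty$ is used. *)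

(* Defs.v *)
From HB Require Import structures.
From mathcomp Require Import all_boot all_order all_algebra.
From mathcomp Require Import all_classical all_reals all_analysis.
Set Implicit Arguments. Unset Strict Implicit. Unset Printing Implicit Defensive.
Import Order.TTheory GRing.Theory Num.Theory.
Local Open Scope ring_scope.

Definition uniform_hg (n m d : nat) (H : {set {set 'I_n}}) : bool :=
  (#|H| == m)%N && [forall e in H, #|e| == d].

Definition hg_connected (n : nat) (H : {set {set 'I_n}}) : bool :=
  [forall V1 : {set 'I_n},
     ((V1 != finset.set0) && (~: V1 != finset.set0)) ==>
     [exists e in H, (e :&: V1 != finset.set0) && (e :&: ~: V1 != finset.set0)]].

Definition prob_connected (R : realType) (n m d : nat) : R :=
  (#|[set H : {set {set 'I_n}} | uniform_hg m d H && hg_connected H]|)%:R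
  / (#|[set H : {set {set 'I_n}} | uniform_hg m d H]|)%:R.

(* log n + m log(1 - d/n) as an extended real, with log 0 = -oo
   (this only happens when d = n; m >= 1 so m * (-oo) = -oo). *)
Definition crit (R : realType) (n m d : nat) : \bar R :=
  if d == n then -oo%E
  else ((ln (n%:R : R)) + (m%:R) * ln (1 - d%:R / n%:R))%:E.

(* Main.v *)
(** Sample the [m] hyperedges with replacement instead, as a function
    ['I_m -> d-sets]: with [N = 'C(n, d)] the sample is injective with
    probability at least [1 - m^2 / N], so conditioning on injectivity at most
    doubles the probability of an event, and turns the sample into [H_nmd].

    If [n (1 - d/n)^m] is large, apply the second moment method to the number
    of isolated nodes: isolation of two nodes is negatively correlated since
    [n |-> 'C(n, d)] is log-concave, so the probability that no node is
    isolated is at most the inverse of the mean [n (1 - d/n)^m].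

    If [w = - ln n - m ln(1 - d/n)] is large, take a union bound over cuts
    [(S, ~: S)] with [s = #|S| <= n/2].  With [q = 1 - d/n] and [z = 2s/n], a
    random [d]-set respects the cut with probability at most
    [q^s (1 + z^2) <= q^(s (1 - t))], where [t = min(z, 7/8)].  Since
    ['C(n, s) <= (e n / s)^s] and [n^t <= e^16 s], the cuts of size [s]
    contribute at most [exp(17 - w/8)^s], which sums to something small. *)

Require Import Defs.
From HB Require Import structures.
From mathcomp Require Import all_boot all_order all_algebra.
From mathcomp Require Import all_classical all_reals all_analysis.
From mathcomp Require Import ring lra zify.
Set Implicit Arguments. Unset Strict Implicit. Unset Printing Implicit Defensive.
Import Order.TTheory GRing.Theory Num.Theory.
Import numFieldNormedType.Exports.
Local Open Scope ring_scope.

(** * Hypergraphs as injective sequences of hyperedges *)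

(** Group the injective [f] by image: each [m]-set [H] is the image of exactly [m!] of them. *)
Lemma card_inj_ffun_image (T : finType) (D : {set T}) (m : nat)
    (P : pred {set T}) :
  (#|[set f : {ffun 'I_m -> T} |
       [&& f \in ffun_on D, injectiveb f & P (f @: 'I_m)]]| =
   m`! * #|[set H : {set T} | [&& H \subset D, #|H| == m & P H]]|)%N.
Proof.
rewrite -sum1dep_card (partition_big (fun f : {ffun 'I_m -> T} => f @: 'I_m)
  (fun H => [&& H \subset D, #|H| == m & P H])) /=; last first.
  move=> f /and3P[/ffun_onP fD /injectiveP fi ->]; rewrite andbT.
  rewrite card_imset // card_ord eqxx andbT.
  by apply/fintype.subsetP => _ /imsetP[i _ ->].
rewrite mulnC -sum_nat_const; under [RHS]eq_bigl do rewrite inE.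
apply: eq_bigr => H /and3P[HD /eqP Hm PH].
have := @card_inj_ffuns_on 'I_m T (mem H).
rewrite card_ord Hm ffactnn => <-; rewrite sum1dep_card; apply: eq_card => f.
rewrite !inE; apply/andP/andP => [[/and3P[_ fi _] /eqP fH]|[/ffun_onP fH fi]].
  by split=> //; apply/ffun_onP => i; rewrite -fH imset_f.
have sub : f @: 'I_m \subset H by apply/fintype.subsetP => _ /imsetP[i _ ->]; exact: fH.
have fE : f @: 'I_m = H.
  by apply/eqP; rewrite eqEcard sub (card_imset _ (injectiveP _ fi)) card_ord Hm /=.
rewrite fE eqxx PH fi !andbT; split=> //.
apply/ffun_onP => i; exact: (fintype.subsetP HD).
Qed.

Definition dsets (n d : nat) : {set {set 'I_n}} := [set e : {set 'I_n} | #|e| == d].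

Lemma card_dsets n d : #|dsets n d| = 'C(n, d).
Proof. by rewrite card_draws card_ord. Qed.

Lemma uniform_hgE n m d (H : {set {set 'I_n}}) :
  uniform_hg m d H = (H \subset dsets n d) && (#|H| == m).
Proof.
rewrite /uniform_hg andbC; congr (_ && _); apply/forall_inP/fintype.subsetP => h e eH.
  by rewrite inE h.
by have := h e eH; rewrite inE.
Qed.

Definition inj_seqs (n m d : nat) (P : pred {set {set 'I_n}}) :=
  [set f : {ffun 'I_m -> {set 'I_n}} |
    [&& f \in ffun_on (dsets n d), injectiveb f & P (f @: 'I_m)]].

Lemma card_uniform_hg n m d (P : pred {set {set 'I_n}}) :
  (#|inj_seqs m d P| = m`! * #|[set H | uniform_hg m d H && P H]|)%N.
Proof.
rewrite card_inj_ffun_image; congr muln; apply: eq_card => H.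
by rewrite !inE uniform_hgE andbA.
Qed.

Lemma card_inj_seqsT n m d :
  #|inj_seqs m d (@predT {set {set 'I_n}})| = 'C(n, d) ^_ m.
Proof.
rewrite -card_dsets -[m in RHS]card_ord -card_inj_ffuns_on.
by apply: eq_card => f; rewrite !inE andbT.
Qed.

Lemma prob_connectedE (R : realType) n m d :
  prob_connected R n m d =
  #|inj_seqs m d (@hg_connected n)|%:R / ('C(n, d) ^_ m)%:R.
Proof.
rewrite -card_inj_seqsT !card_uniform_hg !natrM -mulf_div divff ?mul1r; last first.
  by rewrite pnatr_eq0 -lt0n fact_gt0.
by congr (_ / _%:R); apply: eq_card => H; rewrite !inE andbT.
Qed.

(** The bound on [m] makes the falling factorial nonzero, so 1 can be written as the fraction of all
    injective sequences. *)
Lemma prob_disconnectedE (R : realType) n m d : (m <= 'C(n, d))%N ->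
  1 - prob_connected R n m d =
  #|inj_seqs m d (fun H => ~~ @hg_connected n H)|%:R / ('C(n, d) ^_ m)%:R.
Proof.
move=> mN; have N0 : ('C(n, d) ^_ m)%:R != 0 :> R.
  by rewrite pnatr_eq0 -lt0n ffact_gt0.
rewrite prob_connectedE -[X in X - _](divff N0) -mulrBl; congr (_ / _).
apply/eqP; rewrite subr_eq -natrD eqr_nat -card_inj_seqsT; apply/eqP.
rewrite -(cardsID [set f : {ffun 'I_m -> {set 'I_n}} | hg_connected (f @: 'I_m)]) addnC.
by congr addn; apply: eq_card => f; rewrite !inE /= andbT; case: hg_connected;
  rewrite /= ?andbF ?andbT.
Qed.

(** The ratio is the probability that [m] draws with replacement from [N] objects are distinct.
    Induction on [m]: the next draw is new with probability at least [1 - m / N], and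
    [m^2 + m <= (m + 1)^2]. *)
Lemma ffact_ge (R : realType) (N m : nat) : (0 < N)%N ->
  1 - m%:R ^+ 2 / N%:R <= (N ^_ m)%:R / N%:R ^+ m :> R.
Proof.
move=> N0; have NR : 0 < N%:R :> R by rewrite ltr0n.
elim: m => [|m IH].
  by rewrite expr0n mul0r subr0 ffactn0 expr0 divr1.
have a0 : 0 <= (N ^_ m)%:R / N%:R ^+ m :> R by rewrite divr_ge0 ?exprn_ge0.
have a1 : (N ^_ m)%:R / N%:R ^+ m <= 1 :> R.
  rewrite ler_pdivrMr ?exprn_gt0 // mul1r -natrX ler_nat.
  elim: m {IH a0} => // m IH.
  by rewrite ffactnSr expnSr leq_mul // leq_subr.
rewrite ffactnSr natrM (exprSr N%:R) -mulf_div.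
(* For [m > N] the truncated difference is 0 and the left side is negative. *)
have b : 1 - m%:R / N%:R <= (N - m)%:R / N%:R :> R.
  rewrite -{1}(divff (lt0r_neq0 NR)) -mulrBl ler_pM2r ?invr_gt0 //.
  by rewrite lerBlDr -natrD ler_nat; lia.
apply: (@le_trans _ _ ((N ^_ m)%:R / N%:R ^+ m * (1 - m%:R / N%:R))); last exact: ler_wpM2l.
have c : m.+1%:R ^+ 2 / N%:R = m%:R ^+ 2 / N%:R + m%:R / N%:R + (m.+1)%:R / N%:R :> R.
  by rewrite -natr1; field; rewrite lt0r_neq0.
have e0 : 0 <= m%:R / N%:R :> R by rewrite divr_ge0.
have f0 : 0 <= m.+1%:R / N%:R :> R by rewrite divr_ge0.
rewrite c; nra.
Qed.

(** * Second moment method for isolated nodes *)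

(** Chebyshev's inequality with denominators cleared: with [M = #|A|] and [S] the sum of [X], the
    right side is the sum of [(M X - S)^2], to which each zero of [X] contributes [S^2]. *)
Lemma second_moment (R : realDomainType) (T : finType) (A : {pred T}) (X : T -> R) :
  #|[pred x in A | X x == 0]|%:R * (\sum_(x in A) X x) ^+ 2 <=
  #|A|%:R * (#|A|%:R * (\sum_(x in A) X x ^+ 2) - (\sum_(x in A) X x) ^+ 2).
Proof.
set S := \sum_(x in A) X x; set Q := \sum_(x in A) _; set M : R := #|A|%:R.
have -> : M * (M * Q - S ^+ 2) = \sum_(x in A) (M * X x - S) ^+ 2.
  under eq_bigr => x _ do rewrite sqrrB exprMn.
  rewrite big_split sumrB /= -mulr_sumr sumrMnl sumr_const -[_ *+ #|_|]mulr_natl.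
  by rewrite -mulr_suml -mulr_sumr -/S -/Q -/M; ring.
rewrite mulr_natl -sumr_const big_mkcondr.
apply: ler_sum => x _ /=; case: eqP => [->|_]; last exact: sqr_ge0.
by rewrite mulr0 sub0r sqrrN.
Qed.

(** Node [v] is isolated in the sampled hypergraph. *)
Definition avoids (n m : nat) (f : {ffun 'I_m -> {set 'I_n}}) (v : 'I_n) : bool :=
  [forall i, v \notin f i].

Lemma card_avoiding n m d (W : {set 'I_n}) :
  #|[pred f : {ffun 'I_m -> {set 'I_n}} |
      (f \in ffun_on (dsets n d)) && [forall v in W, avoids f v]]| = ('C(n - #|W|, d) ^ m)%N.
Proof.
have -> : (n - #|W| = #|~: W|)%N.
  by have := cardsC W; rewrite card_ord; lia.
rewrite -cards_draws -[m in RHS]card_ord -card_ffun_on; apply: eq_card => f.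
rewrite !inE; apply/andP/ffun_onP => [[/ffun_onP fD /forall_inP fW] i|h].
  have := fD i; rewrite !inE => ->; rewrite andbT.
  apply/fintype.subsetP => v vf; rewrite inE; apply/negP => /fW /forallP /(_ i).
  by rewrite vf.
split; first by apply/ffun_onP => i; have := h i; rewrite !inE => /andP[].
apply/forall_inP => v vW; apply/forallP => i; apply/negP => vf.
by have := h i; rewrite !inE => /andP[/fintype.subsetP /(_ v vf)]; rewrite inE vW.
Qed.

Lemma sum_avoids (R : nzRingType) n m d :
  \sum_(f : {ffun 'I_m -> {set 'I_n}} | f \in ffun_on (dsets n d))
    \sum_v (avoids f v)%:R = n%:R * ('C(n.-1, d) ^ m)%:R :> R.
Proof.
rewrite exchange_big /=; transitivity (\sum_(v < n) ('C(n.-1, d) ^ m)%:R : R); last first.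
  by rewrite sumr_const card_ord mulr_natl.
apply: eq_bigr => v _; rewrite -subn1 -(cards1 v) -card_avoiding -sumr_const.
rewrite big_mkcondr /=; apply: eq_bigr => f _.
have -> : [forall w in [set v], avoids f w] = avoids f v.
  apply/forall_inP/idP => [h|fv w]; first by apply: h; rewrite inE.
  by rewrite inE => /eqP ->.
by case: avoids.
Qed.

(** Expand the square over pairs of nodes: the diagonal gives the first term, and the [n (n - 1)]
    other pairs, rounded up to [n^2], the second. *)
Lemma sum_avoids_sqr (R : realDomainType) n m d :
  \sum_(f : {ffun 'I_m -> {set 'I_n}} | f \in ffun_on (dsets n d))
    (\sum_v (avoids f v)%:R) ^+ 2 <=
  n%:R * ('C(n.-1, d) ^ m)%:R + n%:R ^+ 2 * ('C(n.-2, d) ^ m)%:R :> R.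
Proof.
have sE : \sum_(f : {ffun 'I_m -> {set 'I_n}} | f \in ffun_on (dsets n d))
    (\sum_v (avoids f v)%:R) ^+ 2 =
    \sum_(u < n) \sum_(v < n) ('C(n - #|[set u; v]|, d) ^ m)%:R :> R.
  under eq_bigr => f _ do rewrite expr2 big_distrlr /=.
  rewrite exchange_big /=; apply: eq_bigr => u _.
  rewrite exchange_big /=; apply: eq_bigr => v _.
  rewrite -card_avoiding -sumr_const big_mkcondr /=; apply: eq_bigr => f _.
  have -> : [forall w in [set u; v], avoids f w] = avoids f u && avoids f v.
    apply/forall_inP/andP => [h|[fu fv] w].
      by split; apply: h; rewrite !inE eqxx ?orbT.
    by rewrite !inE => /orP[] /eqP ->.
  by case: (avoids f u); case: (avoids f v); rewrite ?mulr1 ?mulr0.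
rewrite sE {sE}.
have le (u : 'I_n) : \sum_(v < n) ('C(n - #|[set u; v]|, d) ^ m)%:R <=
    ('C(n.-1, d) ^ m)%:R + n%:R * ('C(n.-2, d) ^ m)%:R :> R.
  rewrite (bigD1 u) //= finset.setUid cards1 subn1 lerD2l.
  apply: (@le_trans _ _ (\sum_(v < n | v != u) ('C(n.-2, d) ^ m)%:R)).
    by apply: ler_sum => v vu; rewrite cards2 eq_sym vu -subn2.
  rewrite sumr_const -[_ *+ #|_|]mulr_natl ler_wpM2r // ler_nat.
  by apply: leq_trans (max_card _) _; rewrite card_ord.
apply: (le_trans (ler_sum _ (fun u _ => le u))).
by rewrite sumr_const card_ord -[_ *+ n]mulr_natl mulrDr expr2 mulrA.
Qed.

(** The identity [n C(n-1, d) = (n - d) C(n, d)], used twice, reduces this to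
    [(n - 1 - d) n <= (n - 1) (n - d)]. For [n <= 1] the predecessors truncate, so these cases are
    separate. *)
Lemma bin_log_concave n d : ('C(n.-2, d) * 'C(n, d) <= 'C(n.-1, d) ^ 2)%N.
Proof.
case: n => [|[|n]] /=; first by rewrite -mulnn.
  by rewrite bin0n; case: d => // d; rewrite mul0n.
have [dn|nd] := leqP d n; last by rewrite bin_small.
have := mul_bin_down n.+1 d; have := mul_bin_down n.+2 d; rewrite /= => e1 e2.
have h : (n.+1 * n.+2 * ('C(n, d) * 'C(n.+2, d)) <= n.+1 * n.+2 * ('C(n.+1, d) ^ 2))%N.
  have h2 : ((n.+1 - d) * n.+2 <= n.+1 * (n.+2 - d))%N.
    by rewrite mulnBl mulnBr leq_sub2l // mulnC leq_mul.
  rewrite (_ : n.+1 * n.+2 * ('C(n, d) * 'C(n.+2, d)) =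
    n.+2 * (n.+1 - d) * ('C(n.+1, d) * 'C(n.+2, d)))%N; last first.
    by rewrite mulnACA e2 mulnACA [(_ * n.+2)%N]mulnC.
  rewrite (_ : n.+1 * n.+2 * ('C(n.+1, d) ^ 2) =
    n.+1 * (n.+2 - d) * ('C(n.+1, d) * 'C(n.+2, d)))%N; last first.
    by rewrite -mulnn mulnACA e1 mulnACA.
  by rewrite leq_mul // mulnC.
by move: h; rewrite leq_pmul2l.
Qed.

Lemma bin_pred (R : realType) n d : (d <= n)%N -> (0 < n)%N ->
  'C(n.-1, d)%:R / 'C(n, d)%:R = 1 - d%:R / n%:R :> R.
Proof.
move=> dn n0; have N0 : 'C(n, d)%:R != 0 :> R by rewrite pnatr_eq0 -lt0n bin_gt0.
have n0' : n%:R != 0 :> R by rewrite pnatr_eq0 -lt0n.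
have := congr1 (fun k => k%:R : R) (mul_bin_down n d).
rewrite !natrM natrB // => e.
apply: (mulfI n0'); rewrite mulrA e mulfK // mulrBr mulr1 mulrCA divff // mulr1 //.
Qed.

Lemma covering_fraction_le (R : realType) n m d : (0 < n)%N -> (d < n)%N ->
  #|[pred f : {ffun 'I_m -> {set 'I_n}} |
      (f \in ffun_on (dsets n d)) && [forall v, ~~ avoids f v]]|%:R / ('C(n, d) ^ m)%:R <=
  (n%:R * (1 - d%:R / n%:R) ^+ m)^-1 :> R.
Proof.
move=> n0 dn.
rewrite -(bin_pred R (ltnW dn) n0) expr_div_n -!natrX.
set Z := (#|_|)%:R; set M := ('C(n, d) ^ m)%:R; set a := ('C(n.-1, d) ^ m)%:R.
have M0 : 0 < M by rewrite ltr0n expn_gt0 bin_gt0 ltnW.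
have a0 : 0 < a by rewrite ltr0n expn_gt0 bin_gt0 -ltnS prednK // dn.
have nR : 0 < n%:R :> R by rewrite ltr0n.
rewrite mulrA invf_div ler_pdivrMr //.
rewrite mulrAC ler_pdivlMr ?mulr_gt0 //.
have := @second_moment R _ (ffun_on (dsets n d))
  (fun f : {ffun 'I_m -> {set 'I_n}} => \sum_v (avoids f v)%:R).
rewrite sum_avoids card_ffun_on card_dsets card_ord -/M -/a.
set Z' := (X in X%:R * _); have -> : Z'%:R = Z.
  congr _%:R; apply: eq_card => f; rewrite !inE; congr (_ && _).
  rewrite -natr_sum pnatr_eq0 sum_nat_eq0; apply: eq_forallb => v.
  by case: avoids.
have := sum_avoids_sqr R n m d; rewrite -/a.
set Q := \sum_(f in _) _; set b := ('C(n.-2, d) ^ m)%:R => hQ h.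
(* Negative correlation: two given nodes are both isolated with probability [b / M <= (a / M)^2]. *)
have hb : M * b <= a ^+ 2.
  rewrite -natrM -natrX ler_nat mulnC -expnMn -expnM [(m * 2)%N]mulnC expnM.
  by have [->|m0] := posnP m; rewrite ?expn0 ?leq_exp2r ?bin_log_concave.
(* The square of the mean absorbs the off-diagonal part of [Q]; only the diagonal term [n a]
   remains. *)
have : Z * (n%:R * a) ^+ 2 <= M * M * (n%:R * a).
  apply: le_trans h _; rewrite -mulrA ler_pM2l //.
  have h1 : M * Q <= M * (n%:R * a + n%:R ^+ 2 * b) by rewrite ler_pM2l.
  have h2 : n%:R ^+ 2 * (M * b) <= n%:R ^+ 2 * a ^+ 2 by rewrite ler_wpM2l ?exprn_ge0.
  by rewrite exprMn; nra.
by rewrite expr2 (mulrA Z (_ * _)) (ler_pM2r (mulr_gt0 nR a0)).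
Qed.

(** * Estimates for a single cut *)

(** Going from [k <= n] nodes to [k - 1] multiplies [C(k, d)] by [1 - d/k <= 1 - d/n]. *)
Lemma bin_sub_le (R : realType) n s d : (d <= n)%N -> (0 < n)%N ->
  'C(n - s, d)%:R <= (1 - d%:R / n%:R) ^+ s * 'C(n, d)%:R :> R.
Proof.
move=> dn n0; have nR : 0 < n%:R :> R by rewrite ltr0n.
have q0 : 0 <= 1 - d%:R / n%:R :> R.
  by rewrite subr_ge0 ler_pdivrMr // mul1r ler_nat.
elim: s => [|s IH]; first by rewrite subn0 expr0 mul1r.
have [dk|kd] := leqP d (n - s); last first.
  by rewrite bin_small ?mulr_ge0 ?exprn_ge0 //; lia.
rewrite exprS -mulrA; apply: le_trans (ler_wpM2l q0 IH).
have [k0|k0] := posnP (n - s).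
  have d0 : d = 0 by move: dk; rewrite k0 leqn0 => /eqP.
  by rewrite d0 !bin0 mul0r subr0 mul1r.
rewrite subnS -ler_pdivrMr ?ltr0n ?bin_gt0 // bin_pred //.
by rewrite lerD2l lerN2 ler_wpM2l // lef_pV2 ?posrE ?ltr0n // ler_nat leq_subr.
Qed.

(** [C(a, d) / a^2] is nondecreasing in [a]: up to [d!] it is [(a - 1) / a] times a falling
    factorial of [a - 2]. *)
Lemma bin_ratio_le a b d : (1 < d)%N -> (a <= b)%N ->
  ('C(a, d) * b ^ 2 <= 'C(b, d) * a ^ 2)%N.
Proof.
case: d => [|[|d]] // _ ab; rewrite -(leq_pmul2r (fact_gt0 d.+2)).
rewrite mulnAC bin_ffact [X in (_ <= X)%N]mulnAC bin_ffact.
case: a b ab => [|a] [|b] // ab; rewrite !ffactSS.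
case: a b ab => [|a] [|b] //; rewrite ?ffactSS ?ffact0n //; try by rewrite !(mul0n, muln0).
rewrite !ltnS => ab.
have h1 : (a ^_ d <= b ^_ d)%N.
  rewrite !ffact_prod; apply: leq_prod => i _; exact: leq_sub2r.
have h2 : (a.+1 * b.+2 <= b.+1 * a.+2)%N by nia.
by have := leq_mul (leqnn (a.+2 * b.+2)%N) (leq_mul h2 h1); rewrite -!mulnn; lia.
Qed.

(** Near [z = 1] the tangent bound [1 + 7z/8] is too small, so the exponent is halved and
    [1 + x <= expR x] is squared. *)
Lemma one_plus_sqr_le_expR (R : realType) (z : R) : 0 <= z <= 1 ->
  1 + z ^+ 2 <= expR (7 / 8 * z).
Proof.
move=> /andP[z0 z1]; have -> : 7 / 8 * z = 7 / 16 * z + 7 / 16 * z by lra.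
rewrite expRD; apply: (@le_trans _ _ ((1 + 7 / 16 * z) * (1 + 7 / 16 * z))); first nra.
by apply: ler_pM; rewrite ?expR_ge1Dx //; lra.
Qed.

(** The first condition wants [t] large, the second wants it small. If [s >= n^(7/8)], then
    [t = 7/8] meets both; otherwise [t = min(z, 7/8)] does. *)
Lemma cut_exponent (R : realType) (n s : nat) : (0 < s)%N -> (2 * s <= n)%N ->
  exists2 t : R, 0 <= t <= 7 / 8 &
    1 + (2 * s%:R / n%:R) ^+ 2 <= expR (t * (2 * s%:R / n%:R)) /\
    t * ln n%:R - ln s%:R <= 16.
Proof.
move=> s0 sn; have sR : 1 <= s%:R :> R by rewrite ler1n.
have nR : 2 * s%:R <= n%:R :> R by rewrite -natrM ler_nat.
set z := 2 * s%:R / n%:R.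
have z01 : 0 <= z <= 1.
  by rewrite /z ler_pdivrMr ?divr_ge0 //; lra.
have ls0 : 0 <= ln s%:R :> R by rewrite ln_ge0.
have [hs|hs] := leP (7 / 8 * ln n%:R) (ln s%:R :> R).
  exists (7 / 8); first by lra.
  split; [exact: one_plus_sqr_le_expR | lra].
(* Here [s < n^(7/8)]. With [E = n^(1/8)] this gives [z <= 2 / E], while [ln n = 8 ln E <= 8 E]; the
   product is 16. *)
have hz : z * ln n%:R <= 16 :> R.
  set E : R := expR (ln n%:R / 8); have E0 : 0 < E := expR_gt0 _.
  have n0 : 0 < n%:R :> R by lra.
  have zE : z <= 2 / E.
    rewrite /z -mulrA ler_pM2l // ler_pdivrMr // mulrC ler_pdivlMr //.
    rewrite -[s%:R]lnK ?posrE; last by lra.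
    rewrite -[X in _ <= X]lnK ?posrE // /E -expRD ler_expR; lra.
  have lE : ln n%:R / 8 <= E by have := expR_ge1Dx (ln n%:R / 8 : R); rewrite -/E; lra.
  apply: (@le_trans _ _ (2 / E * (8 * E))); last first.
    by rewrite mulrACA [E^-1 * E]mulVf ?lt0r_neq0 //; lra.
  by apply: ler_pM => //; [lra | apply: ln_ge0; lra | lra].
have [z78|z78] := leP (7 / 8) z.
  exists (7 / 8); first by lra.
  split; first exact: one_plus_sqr_le_expR.
  have : 7 / 8 * ln n%:R <= z * ln n%:R :> R by rewrite ler_wpM2r // ln_ge0; lra.
  by lra.
exists z; first by lra.
split; first by rewrite -expr2 expR_ge1Dx.
by lra.
Qed.

(** [(s/n)^s C(n, s)] is one term in the expansion of [(1 + s/n)^n <= e^s]. *)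
Lemma bin_le_expR (R : realType) (n s : nat) : (0 < s)%N -> (0 < n)%N ->
  'C(n, s)%:R <= expR (s%:R * (1 + ln n%:R - ln s%:R)) :> R.
Proof.
move=> s0 n0; have [ns|sn] := ltnP n s; first by rewrite bin_small // expR_ge0.
have sR : 0 < s%:R :> R by rewrite ltr0n.
have nR : 0 < n%:R :> R by rewrite ltr0n.
have x0 : 0 < s%:R / n%:R :> R by rewrite divr_gt0.
have h : (s%:R / n%:R) ^+ s * 'C(n, s)%:R <= expR s%:R :> R.
  apply: (@le_trans _ _ ((1 + s%:R / n%:R) ^+ n)); last first.
    rewrite -[X in expR X](@divfK _ n%:R) ?lt0r_neq0 // expRM_natr.
    by rewrite lerXn2r ?nnegrE ?expR_ge0 ?expR_ge1Dx ?addr_ge0 ?ltW.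
  have sn' : (s < n.+1)%N by rewrite ltnS.
  rewrite exprDn (bigD1 (Ordinal sn')) //= expr1n mul1r mulr_natr lerDl.
  by apply: sumr_ge0 => i _; rewrite mulrn_wge0 // expr1n mul1r exprn_ge0 // ltW.
have -> : expR (s%:R * (1 + ln n%:R - ln s%:R)) =
    expR s%:R / (s%:R / n%:R) ^+ s :> R.
  rewrite -addrA mulrDr mulr1 expRD expRM_natl; congr (_ * _).
  rewrite -exprVn; congr (_ ^+ _); rewrite -ln_div ?posrE // lnK ?posrE ?divr_gt0 //.
  by rewrite invf_div.
by rewrite ler_pdivlMr ?exprn_gt0 // mulrC.
Qed.

Lemma one_sub_ratio_bounds (R : realType) (n d : nat) : (0 < d)%N -> (d < n)%N ->
  0 < (1 - d%:R / n%:R : R) < 1.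
Proof.
move=> d0 dn; have nR : 0 < n%:R :> R by rewrite ltr0n (leq_trans _ dn).
by rewrite subr_gt0 ltr_pdivrMr // mul1r ltr_nat dn gtrBl divr_gt0 // ltr0n.
Qed.

(** Since [s / (n - s) <= z = 2s/n], [bin_ratio_le] gives [C(s, d) <= z^2 C(n - s, d)], and
    [C(n - s, d) <= q^s C(n, d)]. As [d >= 2], [z <= - s ln q], so the factor
    [1 + z^2 <= expR (t z)] costs at most [q^(- t s)]. *)
Lemma cut_fraction_le (R : realType) (n d s : nat) (t : R) :
  (1 < d)%N -> (d < n)%N -> (2 * s <= n)%N -> 0 <= t ->
  1 + (2 * s%:R / n%:R) ^+ 2 <= expR (t * (2 * s%:R / n%:R)) ->
  ('C(s, d) + 'C(n - s, d))%:R / 'C(n, d)%:R <=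
    expR ((1 - t) * s%:R * ln (1 - d%:R / n%:R)).
Proof.
move=> d1 dn sn t0 ht.
have nR : 0 < n%:R :> R by rewrite ltr0n; lia.
have N0 : 0 < 'C(n, d)%:R :> R by rewrite ltr0n bin_gt0 ltnW.
have := one_sub_ratio_bounds R (ltnW d1) dn; set q := 1 - _ => /andP[q0 q1].
have lnq : ln q <= - (2 / n%:R).
  apply: (@le_trans _ _ (- (d%:R / n%:R))).
    by apply: le_ln1Dx; move: q0; rewrite /q; lra.
  by rewrite lerN2 ler_pM2r ?invr_gt0 // ler_nat.
have hs : 'C(s, d)%:R <= 'C(n - s, d)%:R * (2 * s%:R / n%:R) ^+ 2 :> R.
  rewrite expr_div_n mulrA ler_pdivlMr ?exprn_gt0 //.
  rewrite -(natrM _ 2 s) -!natrX -!natrM ler_nat.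
  have := bin_ratio_le d1 (_ : s <= n - s)%N => /(_ ltac:(lia)) h.
  apply: (@leq_trans ('C(s, d) * (2 * (n - s)) ^ 2)%N).
    by rewrite leq_mul2l leq_sqr; apply/orP; right; lia.
  by rewrite !expnMn mulnCA [X in (_ <= X)%N]mulnCA leq_mul2l h orbT.
rewrite ler_pdivrMr // natrD.
have h1 := bin_sub_le R s (ltnW dn) (ltac:(lia) : 0 < n)%N.
apply: (@le_trans _ _ ('C(n - s, d)%:R * (1 + (2 * s%:R / n%:R) ^+ 2))); first by lra.
apply: (le_trans (ler_pM (ler0n _ _) (addr_ge0 ler01 (sqr_ge0 _)) h1 ht)).
rewrite -/q mulrAC ler_pM2r //.
rewrite -{1}(lnK (_ : q \is Num.pos)) ?posrE // -expRM_natl -expRD ler_expR.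
have : t * (2 * s%:R / n%:R) <= t * (s%:R * - ln q).
  rewrite ler_wpM2l // [2 * _]mulrC -mulrA ler_wpM2l //; lra.
by lra.
Qed.

(** Divided by [s], the exponent is at most [1 + (t ln n - ln s) - (1 - t) w]; here the bracket is
    at most 16 and [1 - t >= 1/8]. *)
Lemma cut_term_le (R : realType) (n m d s : nat) (w : R) :
  (1 < d)%N -> (d < n)%N -> (0 < s)%N -> (2 * s <= n)%N -> 0 <= w ->
  ln n%:R + m%:R * ln (1 - d%:R / n%:R) <= - w ->
  'C(n, s)%:R * ((('C(s, d) + 'C(n - s, d)) ^ m)%:R / ('C(n, d) ^ m)%:R) <=
    expR (17 - w / 8) ^+ s.
Proof.
move=> d1 dn s0 sn w0 hw.
have [t /andP[t0 t1] [ht hl]] := cut_exponent R s0 sn.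
have hp := cut_fraction_le d1 dn sn t0 ht.
have hb := bin_le_expR R s0 (ltac:(lia) : 0 < n)%N.
rewrite !natrX -expr_div_n.
have hp' := lerXn2r m _ _ hp; rewrite !nnegrE in hp'.
have {}hp' := hp' (divr_ge0 (ler0n _ _) (ler0n _ _)) (expR_ge0 _).
apply: (le_trans (ler_pM (ler0n _ _) (exprn_ge0 _ (divr_ge0 (ler0n _ _) (ler0n _ _))) hb hp')).
rewrite -!expRM_natl -expRD ler_expR.
have sR : 0 < s%:R :> R by rewrite ltr0n.
set l := ln (1 - _) in hw *.
rewrite [X in X <= _](_ : _ = s%:R * (1 + ln n%:R - ln s%:R + (1 - t) * (m%:R * l))); last by ring.
rewrite ler_pM2l //.
have : (1 - t) * (m%:R * l) <= (1 - t) * (- w - ln n%:R) by apply: ler_wpM2l; lra.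
have : t * w <= 7 / 8 * w by rewrite ler_wpM2r.
by lra.
Qed.

(** * Union bound over cuts *)

Lemma sum_geometric_le (R : realType) (r : R) (n : nat) : 0 <= r <= 1 / 2 ->
  \sum_(s < n.+1 | (0 < s)%N) r ^+ s <= 2 * r.
Proof.
move=> /andP[r0 r1]; rewrite big_mkcond big_ord_recl /= add0r.
(* The subtracted term makes the induction go through: [2 r^(n+2) <= r^(n+1)] as [r <= 1/2]. *)
suff: \sum_(i < n) r ^+ i.+1 <= 2 * r - 2 * r ^+ n.+1.
  by move=> h; have := exprn_ge0 n.+1 r0; lra.
elim: n => [|n IH]; first by rewrite big_ord0 expr1 subrr.
by rewrite big_ord_recr /= (exprS _ n.+1); have := exprn_ge0 n.+1 r0; nra.
Qed.

Definition cut_dsets (n d : nat) (S : {set 'I_n}) : {set {set 'I_n}} :=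
  [set e : {set 'I_n} | e \subset S & #|e| == d] :|:
  [set e : {set 'I_n} | e \subset ~: S & #|e| == d].

Lemma card_cut_dsets_le n d (S : {set 'I_n}) :
  (#|cut_dsets d S| <= 'C(#|S|, d) + 'C(n - #|S|, d))%N.
Proof.
apply: (leq_trans (leq_card_setU _ _)); rewrite !cards_draws.
by have := cardsC S; rewrite card_ord => e; rewrite leq_add2l leq_bin2l //; lia.
Qed.

Definition small_cut n (S : {set 'I_n}) : bool := (0 < #|S|)%N && (2 * #|S| <= n)%N.

(** Of the two sides of a cut that no hyperedge crosses, take the smaller; [cut_dsets] is symmetric
    under complement. *)
Lemma disconnected_cut n m d (f : {ffun 'I_m -> {set 'I_n}}) :
  f \in ffun_on (dsets n d) -> ~~ hg_connected (f @: 'I_m) ->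
  [exists S, small_cut S && (f \in ffun_on (cut_dsets d S))].
Proof.
move=> /ffun_onP fD; rewrite negb_forall => /existsP[V].
rewrite negb_imply => /andP[/andP[V0 V1]]; rewrite negb_exists => /forallP hV.
have fV i : f i \in cut_dsets d V.
  have := fD i; have := hV (f i); rewrite imset_f //= !inE => h ->; rewrite !andbT.
  move: h; rewrite negb_and !negbK => /orP[]; rewrite finset.setI_eq0 => h.
    by rewrite -finset.disjoints_subset h orbT.
  by apply/orP; left; rewrite -(finset.setCK V) -finset.disjoints_subset.
have cV := cardsC V; rewrite card_ord in cV.
have [h|h] := leqP (2 * #|V|) n; apply/existsP.
  by exists V; rewrite /small_cut card_gt0 V0 h; apply/ffun_onP.
exists (~: V); rewrite /small_cut card_gt0 V1 /=; apply/andP; split.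
  have aux a b : (a + b = n -> n < 2 * a -> 2 * b <= n)%N by lia.
  exact: aux cV h.
by apply/ffun_onP => i; rewrite /cut_dsets finset.setCK finset.setUC; exact: fV.
Qed.

Lemma card_exists_le (T I : finType) (Q : I -> pred T) (P : pred I) :
  (#|[pred x | [exists i, P i && Q i x]]| <= \sum_(i | P i) #|Q i|)%N.
Proof.
rewrite -sum1_card; under [X in (_ <= X)%N]eq_bigr do rewrite -sum1_card.
under [X in (_ <= X)%N]eq_bigr do rewrite big_mkcond.
rewrite exchange_big /= big_mkcond; apply: leq_sum => x _.
rewrite inE; case: existsP => // -[i /andP[Pi Qi]].
by rewrite (bigD1 i) //= (_ : x \in Q i).
Qed.

Lemma disconnected_fraction_le (R : realType) (n m d : nat) (w : R) :
  (1 < d)%N -> (d < n)%N -> 0 <= w -> expR (17 - w / 8) <= 1 / 2 ->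
  ln n%:R + m%:R * ln (1 - d%:R / n%:R) <= - w ->
  #|[pred f : {ffun 'I_m -> {set 'I_n}} |
      [exists S, small_cut S && (f \in ffun_on (cut_dsets d S))]]|%:R
    / ('C(n, d) ^ m)%:R <= 2 * expR (17 - w / 8).
Proof.
move=> d1 dn w0 r1 hw; set r := expR _ in r1 *.
have r0 : 0 <= r by exact: expR_ge0.
apply: le_trans (@sum_geometric_le R r n _); last by rewrite r0.
pose F s : R := (('C(s, d) + 'C(n - s, d)) ^ m)%:R / ('C(n, d) ^ m)%:R.
have F0 s : 0 <= F s by rewrite divr_ge0.
apply: (@le_trans _ _ (\sum_(S : {set 'I_n} | small_cut S) F #|S|)).
  rewrite /F -mulr_suml ler_wpM2r ?invr_ge0 // -natr_sum ler_nat.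
  apply: leq_trans (card_exists_le _ _) _; apply: leq_sum => S _.
  rewrite card_ffun_on card_ord; have [->|m0] := posnP m; first by rewrite !expn0.
  by rewrite leq_exp2r // card_cut_dsets_le.
(* Group the cuts by size; [inord] is faithful because [#|S| <= n]. *)
rewrite (partition_big (fun S : {set 'I_n} => inord #|S| : 'I_n.+1)
  (fun s => (0 < s)%N && (2 * s <= n)%N)) /=; last first.
  by move=> S; rewrite inordK ?ltnS //; have := max_card S; rewrite card_ord.
rewrite [X in _ <= X](bigID (fun s : 'I_n.+1 => 2 * s <= n)%N) /=.
rewrite -[X in X <= _]addr0; apply: lerD; last by apply: sumr_ge0 => s _; rewrite exprn_ge0.
apply: ler_sum => s /andP[s0 sn].
apply: le_trans (cut_term_le d1 dn s0 sn w0 hw); rewrite -/(F s).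
have -> : 'C(n, s) = #|[set S : {set 'I_n} | #|S| == s]|.
  by rewrite card_draws card_ord.
rewrite mulr_natl -sumr_const big_mkcond [X in _ <= X]big_mkcond /=.
apply: ler_sum => S _; rewrite inE.
case: ifP => [/andP[_ /eqP e]|_]; last by case: ifP.
have -> : #|S| = s by rewrite -e inordK // ltnS; have := max_card S; rewrite card_ord.
by rewrite eqxx.
Qed.

(** * Transfer to the random hypergraph *)

(** [2 m^2 <= C(n, d)] makes a sample with replacement injective with probability at least 1/2, so
    conditioning on this costs a factor of at most 2. *)
Lemma inj_seqs_fraction_le (R : realType) (n m d : nat)
    (P : pred {set {set 'I_n}}) (B : pred {ffun 'I_m -> {set 'I_n}}) :
  (0 < 'C(n, d))%N -> (2 * m ^ 2 <= 'C(n, d))%N ->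
  (forall f : {ffun 'I_m -> {set 'I_n}},
    f \in ffun_on (dsets n d) -> P (f @: 'I_m) -> B f) ->
  #|inj_seqs m d P|%:R / ('C(n, d) ^_ m)%:R <=
    2 * (#|B|%:R / ('C(n, d) ^ m)%:R) :> R.
Proof.
move=> N0 mN hB; have NR : 0 < 'C(n, d)%:R :> R by rewrite ltr0n.
have h : 1 / 2 <= ('C(n, d) ^_ m)%:R / ('C(n, d) ^ m)%:R :> R.
  rewrite natrX; apply: le_trans (ffact_ge R m N0).
  have : m%:R ^+ 2 / 'C(n, d)%:R <= 1 / 2 :> R; last by lra.
  have : 2 * m%:R ^+ 2 <= 'C(n, d)%:R :> R by rewrite -natrX -natrM ler_nat.
  by rewrite ler_pdivrMr //; lra.
have M0 : 0 < ('C(n, d) ^ m)%:R :> R by rewrite ltr0n expn_gt0 N0.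
have F0 : 0 < ('C(n, d) ^_ m)%:R :> R.
  by move: h; rewrite ler_pdivlMr //; lra.
have hc : #|inj_seqs m d P|%:R <= #|B|%:R :> R.
  rewrite ler_nat; apply: subset_leq_card; apply/fintype.subsetP => f.
  by rewrite inE => /and3P[fD _ fP]; exact: hB.
move: h; rewrite ler_pdivlMr // => h.
rewrite ler_pdivrMr // mulrA mulrAC ler_pdivlMr //.
apply: (@le_trans _ _ (#|B|%:R * ('C(n, d) ^ m)%:R)); first by rewrite ler_pM2r.
by rewrite [2 * _]mulrC -mulrA ler_wpM2l //; lra.
Qed.

(** Apply connectedness to the cut [{v}], whose other side is nonempty as [n > 1]. *)
Lemma connected_covers n (H : {set {set 'I_n}}) (v : 'I_n) : (1 < n)%N ->
  hg_connected H -> exists2 e, e \in H & v \in e.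
Proof.
move=> n1 /forallP /(_ [set v]) /implyP h.
have /existsP[e /and3P[eH ev _]] : [exists e in H,
    (e :&: [set v] != finset.set0) && (e :&: ~: [set v] != finset.set0)].
  by apply: h; rewrite -!card_gt0 cards1 cardsC1 card_ord -subn1 subn_gt0.
exists e => //; have /finset.set0Pn[w] := ev.
by rewrite !inE => /andP[we /eqP <-].
Qed.

Lemma prob_connected_le (R : realType) n m d : (1 < n)%N -> (d < n)%N ->
  (2 * m ^ 2 <= 'C(n, d))%N ->
  prob_connected R n m d <= 2 * (n%:R * (1 - d%:R / n%:R) ^+ m)^-1.
Proof.
move=> n1 dn mN; rewrite prob_connectedE.
have N0 : (0 < 'C(n, d))%N by rewrite bin_gt0 ltnW.
apply: le_trans (ler_wpM2l _ (covering_fraction_le R m (ltnW n1) dn)) => //.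
apply: inj_seqs_fraction_le => // f fD fc; rewrite /= fD /=.
apply/forallP => v; have [_ /imsetP[i _ ->] vf] := connected_covers v n1 fc.
by apply/negP => /forallP /(_ i); rewrite vf.
Qed.

Lemma prob_disconnected_le (R : realType) n m d (w : R) :
  (1 < d)%N -> (d < n)%N -> (2 * m ^ 2 <= 'C(n, d))%N ->
  0 <= w -> expR (17 - w / 8) <= 1 / 2 ->
  ln n%:R + m%:R * ln (1 - d%:R / n%:R) <= - w ->
  1 - prob_connected R n m d <= 4 * expR (17 - w / 8).
Proof.
move=> d1 dn mN w0 r1 hw.
have N0 : (0 < 'C(n, d))%N by rewrite bin_gt0 ltnW.
rewrite prob_disconnectedE; last by rewrite (leq_trans _ mN) //; nia.
have -> : 4 * expR (17 - w / 8) = 2 * (2 * expR (17 - w / 8)) by lra.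
apply: le_trans (ler_wpM2l _ (disconnected_fraction_le d1 dn w0 r1 hw)) => //.
by apply: inj_seqs_fraction_le => // f fD fc; exact: disconnected_cut.
Qed.

Lemma prob_connected_bounds (R : realType) n m d :
  0 <= prob_connected R n m d <= 1.
Proof.
rewrite /prob_connected; apply/andP; split; first by rewrite divr_ge0.
set a := #|_|; set b := #|_|; have ab : (a <= b)%N.
  by apply: subset_leq_card; apply/fintype.subsetP => H; rewrite !inE => /andP[].
(* With no hypergraph to sample, the quotient is 0 by convention. *)
have [b0|b0] := posnP b; first by rewrite b0 invr0 mulr0.
by rewrite ler_pdivrMr ?ltr0n // mul1r ler_nat.
Qed.

(** * Passage to the limit *)

Lemma sqr_le_of_ratio (R : realType) (m N : nat) : (0 < N)%N ->
  m%:R / Num.sqrt N%:R <= 1 / 2 :> R -> (4 * m ^ 2 <= N)%N.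
Proof.
move=> N0; have NR : 0 < N%:R :> R by rewrite ltr0n.
rewrite ler_pdivrMr ?sqrtr_gt0 // => h.
rewrite -(ler_nat R) natrM natrX -[N%:R]sqr_sqrtr; last exact: ltW.
by have := ler_pM (ler0n _ _) (ler0n _ _) h h; rewrite !expr2; lra.
Qed.

Local Open Scope classical_set_scope.

Theorem mainTheorem2 (R : realType) (m d : nat -> nat) :
  (forall n, (2 <= n)%N -> (1 <= m n)%N /\ (2 <= d n <= n)%N) ->
  (fun n => (m n)%:R / Num.sqrt ('C(n, d n))%:R : R) @ \oo --> (0 : R) ->
  ((fun n => crit R n (m n) (d n)) @ \oo --> +oo%E ->
     (fun n => prob_connected R n (m n) (d n)) @ \oo --> (0 : R)) /\
  ((fun n => crit R n (m n) (d n)) @ \oo --> -oo%E ->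
     (fun n => prob_connected R n (m n) (d n)) @ \oo --> (1 : R)).
Proof.
move=> hmd hm.
have side : \forall n \near \oo,
    [/\ (1 < n)%N, (1 < d n < n)%N & (2 * m n ^ 2 <= 'C(n, d n))%N].
  have h2 : 0 < 1 / 2 :> R by lra.
  move/cvgrPdist_le: hm => /(_ _ h2) hm; near=> n.
  have n1 : (1 < n)%N by near: n; exists 2.
  have [m1 /andP[d1 dn]] := hmd n n1.
  have h4 : (4 * m n ^ 2 <= 'C(n, d n))%N.
    apply: (@sqr_le_of_ratio R); first by rewrite bin_gt0.
    have : `|0 - (m n)%:R / Num.sqrt ('C(n, d n))%:R| <= 1 / 2 :> R by near: n.
    by rewrite sub0r normrN; apply: le_trans; exact: ler_norm.
  split=> //; last by lia.
  (* If [d n = n] the binomial is 1, contradicting [4 m^2 <= 1] with [m >= 1]. So [crit] is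
     eventually finite. *)
  rewrite d1 ltn_neqAle dn andbT; apply/eqP => dE; move: h4; rewrite dE binn.
  by have : (1 <= m n ^ 2)%N; [rewrite expn_gt0 m1 | lia].
split=> [/cvgeyPge hc|/cvgeNyPle hc]; apply/cvgrPdist_le => e e0; near=> n.
- have [n1 /andP[d1 dn] mN] : [/\ (1 < n)%N, (1 < d n < n)%N &
    (2 * m n ^ 2 <= 'C(n, d n))%N] by near: n.
  (* This threshold says [n q^m >= 2 / e], which makes the bound [2 / (n q^m)] at most [e]. *)
  have : ((- ln (e / 2))%:E <= crit R n (m n) (d n))%E by near: n; exact: hc.
  rewrite /crit ltn_eqF // lee_fin => hn.
  have /andP[p0 _] := prob_connected_bounds R n (m n) (d n).
  rewrite sub0r normrN ger0_norm //.
  apply: (le_trans (prob_connected_le R n1 dn mN)).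
  have /andP[q0 q1] := one_sub_ratio_bounds R (ltnW d1) dn.
  have nR : 0 < n%:R :> R by rewrite ltr0n ltnW.
  have e2 : 0 < e / 2 by lra.
  rewrite mulrC -ler_pdivlMr // -[e / 2]invrK lef_pV2 ?posrE ?invr_gt0 ?mulr_gt0 ?exprn_gt0 //.
  rewrite -[X in X <= _]lnK ?posrE ?invr_gt0 // lnV ?posrE //.
  rewrite [X in _ <= X](_ : _ = expR (ln n%:R + (m n)%:R * ln (1 - (d n)%:R / n%:R))).
    by rewrite ler_expR.
  by rewrite expRD expRM_natl !lnK ?posrE.
- have [n1 /andP[d1 dn] mN] : [/\ (1 < n)%N, (1 < d n < n)%N &
    (2 * m n ^ 2 <= 'C(n, d n))%N] by near: n.
  (* The target for [expR (17 - w / 8)]: 1/2 for the geometric series, [e / 4] for the final factor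
     4. Solving for [w] gives [8 (17 - ln c)], raised to 0 if negative. *)
  pose c : R := Num.min (1 / 2) (e / 4).
  have c0 : 0 < c by rewrite lt_min; apply/andP; split; lra.
  have [c1 c2] : c <= 1 / 2 /\ c <= e / 4 by rewrite /c !ge_min !lexx orbT.
  pose w := Num.max 0 (8 * (17 - ln c)).
  have [w0 w1] : 0 <= w /\ 8 * (17 - ln c) <= w by rewrite /w !le_max !lexx orbT.
  have : (crit R n (m n) (d n) <= (- w)%:E)%E by near: n; exact: hc.
  rewrite /crit ltn_eqF // lee_fin => hn.
  have /andP[_ p1] := prob_connected_bounds R n (m n) (d n).
  have rc : expR (17 - w / 8) <= c.
    by rewrite -[X in _ <= X]lnK ?posrE // ler_expR; lra.
  rewrite ger0_norm ?subr_ge0 //.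
  apply: (le_trans (prob_disconnected_le d1 dn mN w0 _ hn)); lra.
Unshelve. all: by end_near.
Qed.
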